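(* Let $1 < p < \infty$, let $p' = \frac{p}{p-1}$ and $\alpha = \frac{1}{p'}$. Then the operator $I'_\alpha$ maps $H_1(\mathfrak{X})$ to $L_p(\mathfrak{X})$ continuously. In other words, there is a constant $C = C(p)$, depending only on $p$, such that for all functions $F \in H_1(\mathfrak{X})$ the series $$I'_\alpha[F] = \sum_{n=1}^\infty (E_n - E_{n-1})M_n F$$ converges in $L_p(\mathfrak{X})$ and the inequality $$\|I'_\alpha[F]\|_p \leq C\|F^*\|_1$$ holds.
   Context: $\mathfrak{X} = (\Omega, \mathcal{F}, \mathbb{P})$ is a probability space with a sequence of sigma-algebras $\mathcal{F}_0 \subset \mathcal{F}_1 \subset \dots \subset \mathcal{F}$ such that: for any two distinct points $\omega_1, \omega_2 \in \Omega$ there are $n$ and $X \in \mathcal{F}_n$ with $\omega_1 \in X$, $\omega_2 \notin X$; $\mathcal{F}_0 = \{\varnothing, \Omega\}$; and each $\mathcal{F}_n$ is generated by a finite or countable set of atoms, i.e. there is a finite or countable partition $\Omega = \bigsqcup_j a_j$ such that $\mathcal{F}_n$ is generated by the events $a_j$ (called the atoms of $\mathcal{F}_n$). Operators: $E_n f = \mathbb{E}(f \mid \mathcal{F}_n)$. For a parameter $\alpha \in [0,1)$, $[M_n f](\omega) = b_n^\alpha(\omega) f(\omega)$, where $b_n(\omega) = \mathbb{P}(a)$ and $a$ is the atom of $\mathcal{F}_n$ containing $\omega$. The operator $I'_\alpha[F] = \sum_{n=1}^\infty (E_n - E_{n-1})M_n F$ is the formal conjugate of the Riesz potential $I_\alpha[F]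 = \sum_{n=1}^\infty M_n(E_n - E_{n-1})F$. The space $H_1(\mathfrak{X}) = H_1(\mathfrak{X},\{\mathcal{F}_n\})$: for an integrable random variable $F$, let $F_n = \mathbb{E}(F\mid\mathcal{F}_n)$ and let $F^* = \sup_{n \geq 0}|F_n|$ be the maximal function. Then $F \in H_1(\mathfrak{X})$ if $F^* \in L_1(\mathfrak{X})$, and $\|F\|_{H_1} = \|F^*\|_1$. *)

(* Defs.v *)
From HB Require Import structures.
From mathcomp Require Import all_boot all_order all_algebra.
From mathcomp Require Import all_classical all_reals all_analysis measurable_realfun.

Set Implicit Arguments.
Unset Strict Implicit.
Unset Printing Implicit Defensive.
Import Order.TTheory GRing.Theory Num.Theory.
Import numFieldTopology.Exports numFieldNormedType.Exports.
Local Open Scope classical_set_scope.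
Local Open Scope ring_scope.

Section conditional_expectation.
Context d (T : measurableType d) (R : realType) (P : probability T R).

(* g is a version of E(f | G), for a sub-sigma-algebra G *)
Definition is_cond_exp (G : set (set T)) (f g : T -> R) : Prop :=
  [/\ forall B : set R, measurable B -> G (g @^-1` B),
      P.-integrable setT (EFin \o g) &
      forall A, G A -> (\int[P]_(x in A) (g x)%:E = \int[P]_(x in A) (f x)%:E)%E].

(* A fixed version of E(f | G); lemma cond_expP below shows that it is one
   whenever f is integrable, so the default value 0 is then not used. *)
Definition cond_exp (G : set (set T)) (f : T -> R) : T -> R :=
  xget (fun=> 0) [set g | is_cond_exp G f g].

Let cond_exp_pushforward d' (T' : measurableType d') (h : T -> T')
    (mh : measurable_fun setT h) (f : T -> R) :
  P.-integrable setT (EFin \o f) -> exists g : T' -> R,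
  [/\ measurable_fun setT g, P.-integrable setT (EFin \o (g \o h)) &
      forall A, measurable A ->
        (\int[P]_(x in h @^-1` A) (g (h x))%:E
         = \int[P]_(x in h @^-1` A) (f x)%:E)%E].
Proof.
move=> intf.
pose pmu : {measure set T' -> \bar R} := pushforward P h.
pose pnu : {charge set T' -> \bar R} := pushforward (induced_charge intf) h.
pose mu0 := pmu mh; pose nu := pnu mh.
have mhA A : measurable A -> measurable (h @^-1` A).
  by move=> mA; rewrite -[X in measurable X]setTI; exact: (mh measurableT).
have mu0fin : fin_num_fun mu0.
  by move=> A mA; apply: fin_num_measure; exact: mhA.
pose mu0f := @Measure_isFinite.Build _ T' R mu0 mu0fin.
pose mu : {finite_measure set T' -> \bar R} := HB.pack (Measure.sort mu0) mu0f.
have numu : nu `<< mu.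
  apply: dominates_pushforward => //.
  apply/null_content_dominatesP => A mA PA0.
  rewrite /induced_charge; apply: null_set_integral => //.
  exact: (measurable_int P (integrableS measurableT mA (@subsetT _ _) intf)).
pose g := Radon_Nikodym nu mu.
have gE : EFin \o (fine \o g) = g.
  by apply/funext => x /=; rewrite fineK// Radon_Nikodym_fin_num.
have ig : mu.-integrable setT g by exact: Radon_Nikodym_integrable.
have mg := measurable_int _ ig.
have igP : P.-integrable setT (g \o h).
  apply/integrableP; split; first exact: (measurableT_comp mg mh).
  move/integrableP : (ig) => [_]; apply: le_lt_trans.
  rewrite (@ge0_integral_pushforward _ _ _ _ _ _ mh P)//.
  exact: measurableT_comp.
exists (fine \o g); split.
- by apply/measurable_EFinP; rewrite gE.
- by rewrite (_ : _ \o _ = (EFin \o (fine \o g)) \o h)// gE.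
- move=> A mA; rewrite -[RHS](_ : nu A = _)//.
  rewrite (Radon_Nikodym_integral numu mA).
  rewrite (@integral_pushforward _ _ _ _ _ _ mh P)//; last first.
    by apply: integrableS igP => //; exact: mhA.
  by apply: eq_integral => x _; rewrite -[LHS]/((EFin \o (fine \o g)) (h x)) gE.
Qed.

Lemma is_cond_exp_exists (G : set (set T)) (f : T -> R) :
  sigma_algebra setT G -> G `<=` measurable ->
  P.-integrable setT (EFin \o f) -> exists g, is_cond_exp G f g.
Proof.
move=> sG Gm intf.
have GE : <<s G >> = G by exact: sigma_algebra_id.
have mG (A : set T) : measurable (A : set (g_sigma_algebraType G)) = G A.
  by rewrite /measurable/= GE.
pose h : T -> g_sigma_algebraType G := idfun.
have mh : measurable_fun setT h.
  by move=> _ /= A; rewrite mG => GA; rewrite setTI; exact: Gm.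
have [g [mg ig gE]] := cond_exp_pushforward mh intf.
exists g; split => //.
- by move=> B mB; rewrite -mG -[X in measurable X]setTI; exact: mg.
- by move=> A GA; apply: gE; rewrite mG.
Qed.

Lemma cond_expP (G : set (set T)) (f : T -> R) :
  sigma_algebra setT G -> G `<=` measurable ->
  P.-integrable setT (EFin \o f) -> is_cond_exp G f (cond_exp G f).
Proof.
move=> sG Gm intf; have [g gE] := is_cond_exp_exists sG Gm intf.
exact: (@xgetPex _ (fun=> 0) [set g | is_cond_exp G f g] (ex_intro _ g gE)).
Qed.

End conditional_expectation.

(* The n-th sigma-algebra is generated by the partition of T into the nonempty
   sets atom n j, j ranging over the (finite or infinite) set atom_index n of
   naturals. *)
Record atomic_filtration d (T : measurableType d) := AtomicFiltration {
  filt :> nat -> set (set T) ;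
  atom_index : nat -> set nat ;
  atom : nat -> nat -> set T ;
  atom_partition : forall n, partition (atom_index n) (atom n) setT ;
  filt_generated : forall n, filt n = <<s atom n @` atom_index n >> ;
  filt_measurable : forall n, filt n `<=` measurable ;
  filt_nondecreasing : forall n, filt n `<=` filt n.+1 ;
  filt_trivial : filt 0%N = [set set0; setT] ;
  filt_separates : forall w1 w2 : T, w1 <> w2 ->
    exists n A, [/\ filt n A, A w1 & ~ A w2] }.

Section martingale_operators.
Context d (T : measurableType d) (R : realType) (P : probability T R).
Variable X : atomic_filtration T.

Definition E_ (n : nat) (f : T -> R) : T -> R := cond_exp P (X n) f.

Definition atom_prob (n : nat) (w : T) : R :=
  fine (P (pblock (atom_index X n) (atom X n) w)).

Definition M_ (alpha : R) (n : nat) (f : T -> R) : T -> R :=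
  fun w => atom_prob n w `^ alpha * f w.

Definition riesz_conj_partial (alpha : R) (F : T -> R) (N : nat) : T -> R :=
  fun w => \sum_(1 <= n < N.+1)
    (E_ n (M_ alpha n F) w - E_ n.-1 (M_ alpha n F) w).

Definition maximal_fun (F : T -> R) : T -> \bar R :=
  fun w => ereal_sup [set `|E_ n F w|%:E | n in [set: nat]].

Definition H1 (F : T -> R) : Prop :=
  P.-integrable setT (EFin \o F) /\ P.-integrable setT (maximal_fun F).

Definition H1_norm (F : T -> R) : \bar R := 'N[P]_1%E [maximal_fun F]%E.

Definition Lp_cvg (p : R) (S : nat -> T -> R) (G : T -> R) : Prop :=
  [/\ forall N, S N \in Lfun P p%:E, G \in Lfun P p%:E &
      ('N[P]_p%:E [EFin \o (fun w => S N w - G w)%R] @[N --> \oo] --> 0)%E].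

End martingale_operators.

(* Main.v *)
(** Write [b_n] for the probability of the current atom, [F_n = E_n F],
    [phi_n = max_(k <= n) |F_k|], [K] for the integral of the maximal function
    and [a = 1 - 1/p]. Since [E_n (M_n F) = b_n^a F_n], telescoping gives
      [S_N = b_N^a F_N - b_0^a F_0 + sum_(n < N) u_n],
      [u_n = E_n ((b_n^a - b_(n+1)^a) F_(n+1))].
    Splitting [phi_(n+1) = phi_n + (phi_(n+1) - phi_n)] bounds [|u_n|] by a
    multiple of [(b_n^a - b_(n+1)^a) phi_n] plus
    [b_n^a E_n (phi_(n+1) - phi_n)], and summation by parts bounds [|S_N|] by
    a multiple of [J_N + B_N], where
      [J_N = sum_(k <= N) b_k^a (phi_k - phi_(k-1))],
      [B_N = sum_(k < N) b_k^a E_k (phi_(k+1) - phi_k)].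
    With [a] replaced by 1 both sums are at most [K] at every point. An
    elementary inequality for real sequences upgrades this to the pointwise
    bound
      [|S_N|^p <= C K^(p-1) (phi_N + sum_(k < N) E_k (phi_(k+1) - phi_k))],
    whose right-hand side increases to a function of integral at most
    [2 C K^p]. Wherever that function is finite, [S_N] converges, and dominated
    convergence concludes. *)
Require Import Defs.
From mathcomp Require Import all_boot all_order all_algebra.
From mathcomp Require Import all_classical all_reals all_analysis measurable_realfun.
From mathcomp Require Import ring lra.

Set Implicit Arguments.
Unset Strict Implicit.
Unset Printing Implicit Defensive.
Import Order.TTheory GRing.Theory Num.Theory.
Import numFieldTopology.Exports numFieldNormedType.Exports.
Local Open Scope classical_set_scope.
Local Open Scope ring_scope.

(** * Convexity and summation inequalities for real sequences *)

Section real_sequences.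
Context {R : realType}.
Implicit Types (a b c p x y K : R).

(** Young's inequality for [x] and [y^(p-1)], with conjugate exponents [p] and [p / (p - 1)], gives
    this tangent-line form of the convexity of the [p]-th power. *)
Lemma powRB_le p x y : 1 < p -> 0 <= x -> 0 <= y ->
  y `^ p - x `^ p <= p * y `^ (p - 1) * (y - x).
Proof.
move=> p1 x0 y0.
have pp : 0 < p by lra.
have pn : p != 0 by rewrite gt_eqF.
have pm : p - 1 != 0 by rewrite gt_eqF// subr_gt0.
have q0 : 0 < p / (p - 1) by rewrite divr_gt0// subr_gt0.
have e : p^-1 + (p / (p - 1))^-1 = 1 by field; rewrite pn pm.
have := conjugate_powR x0 (powR_ge0 y (p - 1)) pp q0 e.
rewrite -powRrM (_ : (p - 1) * (p / (p - 1)) = p); last by field.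
rewrite -(ler_pM2l pp).
rewrite (_ : p * (x `^ p / p + y `^ p / (p / (p - 1)))
   = x `^ p + (p - 1) * y `^ p); last by field; rewrite pn pm.
have -> : y `^ p = y `^ (p - 1) * y.
  have [->|yn] := eqVneq y 0; first by rewrite powR0 ?mulr0.
  by rewrite -[in X in _ * X](powRr1 y0) -powRD ?yn ?implybT// subrK.
lra.
Qed.

(** This is [powRB_le] with exponent [1 + a^-1], applied to the [a]-th powers of [c] and [b]. It
    serves to compare the probabilities of a cell and of one of its children. *)
Lemma powR1DB_le a b c : 0 < a -> 0 <= c -> 0 <= b ->
  b `^ (1 + a) - c `^ (1 + a) <= (1 + a^-1) * b * (b `^ a - c `^ a).
Proof.
move=> a0 c0 b0; have an : a != 0 by rewrite gt_eqF.
have s1 : 1 < 1 + a^-1 by rewrite ltrDl invr_gt0.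
have := powRB_le s1 (powR_ge0 c a) (powR_ge0 b a).
rewrite -!powRrM (_ : a * (1 + a^-1) = 1 + a); last by field.
by rewrite (_ : a * (1 + a^-1 - 1) = 1) ?powRr1//; field.
Qed.

(* With [a = 1 - p^-1]: since
   [\sum_(k < n.+1) c k `^ a * u k <= c n `^ (a - 1) * K] and [(a - 1) * (p - 1) + a = 0],
   the increment of the [p]-th power at [n] is at most
   [p * K `^ (p - 1) * u n]. *)
Lemma sum_powR_le p K (c u : nat -> R) n : 1 < p ->
  (forall k, 0 < c k) -> (forall k, c k.+1 <= c k) -> (forall k, 0 <= u k) ->
  (forall m, \sum_(k < m) c k * u k <= K) ->
  (\sum_(k < n) c k `^ (1 - p^-1) * u k) `^ p
    <= p * K `^ (p - 1) * \sum_(k < n) u k.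
Proof.
move=> p1 c0 cS u0 cuK; have pp : 0 < p by lra.
have pn : p != 0 by rewrite gt_eqF.
have K0 : 0 <= K by have := cuK 0%N; rewrite big_ord0.
have cle i j : (i <= j)%N -> c j <= c i.
  by move=> ij; apply: (@nonincreasing_seqP _ _ c).1.
elim: n => [|n IH]; first by rewrite !big_ord0 mulr0 powR0.
set T := fun m => \sum_(k < m) c k `^ (1 - p^-1) * u k.
have T0 m : 0 <= T m by apply: sumr_ge0 => i _; rewrite mulr_ge0 ?powR_ge0.
(* Split [c k^(1-1/p)] as [c k] times [c k^(-1/p)]; the second factor is largest at [k = n], because
   [c] is nonincreasing and the exponent is negative. *)
have TK : T n.+1 <= c n `^ (- p^-1) * K.
  apply: (@le_trans _ _ (c n `^ (- p^-1) * \sum_(k < n.+1) c k * u k)); last first.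
    by rewrite ler_wpM2l ?powR_ge0.
  rewrite mulr_sumr ler_sum// => k _; rewrite mulrA ler_wpM2r//.
  rewrite powRD ?(gt_eqF (c0 k)) ?implybT// powRr1 ?(ltW (c0 _))// mulrC.
  rewrite ler_wpM2r ?(ltW (c0 _))//.
  rewrite !powRN lef_pV2 ?posrE ?powR_gt0//.
  by rewrite ge0_ler_powR ?nnegrE ?invr_ge0 ?(ltW (c0 _)) ?(ltW pp) ?cle// -ltnS.
have TS : T n.+1 `^ (p - 1) * c n `^ (1 - p^-1) <= K `^ (p - 1).
  apply: (@le_trans _ _ ((c n `^ (- p^-1) * K) `^ (p - 1) * c n `^ (1 - p^-1))).
    rewrite ler_wpM2r ?powR_ge0// ge0_ler_powR ?nnegrE//; first by lra.
    by rewrite mulr_ge0 ?powR_ge0.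
  rewrite powRM ?powR_ge0// -powRrM mulrAC -powRD ?(gt_eqF (c0 n)) ?implybT//.
  by rewrite (_ : _ + _ = 0) ?powRr0 ?mul1r//; field.
have H := powRB_le p1 (T0 n) (T0 n.+1).
rewrite [X in _ * X]big_ord_recr/= mulrDr -lerBlDl; apply: le_trans (lerB (lexx _) IH) _.
apply: le_trans H _.
have -> : T n.+1 - T n = c n `^ (1 - p^-1) * u n.
  by rewrite /T big_ord_recr/= addrAC subrr add0r.
by rewrite -!mulrA ler_wpM2l ?(ltW pp)// mulrA ler_wpM2r.
Qed.

(** The value before index 0 is taken to be 0, so that summation by parts leaves no boundary term at
    0. *)
Definition increment (phi : nat -> R) (n : nat) : R :=
  if n is m.+1 then phi m.+1 - phi m else phi 0%N.

Lemma sum_increment (phi : nat -> R) n :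
  \sum_(k < n.+1) increment phi k = phi n.
Proof.
elim: n => [|n IH]; first by rewrite big_ord1.
by rewrite big_ord_recr/= IH addrC subrK.
Qed.

Lemma summation_by_parts (v phi : nat -> R) n :
  \sum_(k < n) (v k - v k.+1) * phi k + v n * phi n
    = \sum_(k < n.+1) v k * increment phi k.
Proof.
elim: n => [|n IH]; first by rewrite big_ord0 big_ord1 add0r.
by rewrite big_ord_recr/= [in RHS]big_ord_recr/= -IH; ring.
Qed.

End real_sequences.

(** * Limits of real powers *)

Lemma cvgn_powR0 {R : realType} (r : R) (u : nat -> R) : 0 < r ->
  (forall n, 0 <= u n) -> u @ \oo --> 0 -> (fun n => u n `^ r) @ \oo --> 0.
Proof.
move=> r0 u0 ucvg; apply/cvgr0Pnorm_lt => e e0.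
have er0 : 0 < e `^ r^-1 by rewrite powR_gt0.
move/cvgr0Pnorm_lt : ucvg => /(_ _ er0); apply: filterS => n.
rewrite !ger0_norm ?powR_ge0// => une.
rewrite -(powRr1 (ltW e0)) -(mulVf (lt0r_neq0 r0)) powRrM.
by rewrite gt0_ltr_powR// nnegrE ?powR_ge0.
Qed.

Lemma cvgn_powR {R : realType} (r l : R) (u : nat -> R) : 0 < l ->
  u @ \oo --> l -> (fun n => u n `^ r) @ \oo --> l `^ r.
Proof.
move=> l0 ucvg; apply: (cvg_comp u (@powR R ^~ r) ucvg).
have /derivable1_diffP/differentiable_continuous : derivable (@powR R ^~ r) l 1.
  by apply: derivable_powR; rewrite in_itv/= l0.
exact.
Qed.

(** * Deterministic estimates along a single path *)

Section pathwise.
Context {R : realType}.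
(** At a fixed point, [b n] will be the atom probability, [f n] the value of [E_n F], [phi n] the
    running maximum, [g n] the conditional expectation of its next jump, and [y n] the value of
    [E_n (M_(n+1) F)]. *)
Variables (p K : R) (b f phi g y : nat -> R).
Hypotheses (p1 : 1 < p) (b0 : forall n, 0 < b n)
  (bS : forall n, b n.+1 <= b n) (phiS : forall n, phi n <= phi n.+1)
  (f_phi : forall n, `|f n| <= phi n) (g0 : forall n, 0 <= g n).
Let a : R := 1 - p^-1.
Hypothesis u_le : forall n, `|b n `^ a * f n - y n|
  <= (1 + a^-1) * ((b n `^ a - b n.+1 `^ a) * phi n) + b n `^ a * g n.

Let a0 : 0 < a.
Proof. by rewrite subr_gt0 invf_lt1// (lt_trans ltr01). Qed.

Let S N := \sum_(n < N) (b n.+1 `^ a * f n.+1 - y n).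
Let J N := \sum_(k < N.+1) b k `^ a * increment phi k.
Let B N := \sum_(k < N) b k `^ a * g k.

Let phi0 n : 0 <= phi n. Proof. exact: le_trans (f_phi n). Qed.

Let incr0 n : 0 <= increment phi n.
Proof. by case: n => [|n] /=; rewrite ?subr_ge0. Qed.

Let bpow_le n m : (n <= m)%N -> b m `^ a <= b n `^ a.
Proof.
move=> nm; rewrite ge0_ler_powR ?nnegrE ?(ltW a0) ?(ltW (b0 _))//.
exact: (@nonincreasing_seqP _ _ b).1.
Qed.

Let JE N : \sum_(k < N) (b k `^ a - b k.+1 `^ a) * phi k + b N `^ a * phi N = J N.
Proof. exact: (summation_by_parts (fun k => b k `^ a)). Qed.

Let sum_u_le N : \sum_(n < N) `|b n `^ a * f n - y n| <= (1 + a^-1) * J N + B N.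
Proof.
apply: (le_trans (ler_sum _ (fun (i : 'I_N) _ => u_le i))).
rewrite big_split/= -mulr_sumr lerD2r ler_wpM2l ?addr_ge0 ?invr_ge0 ?(ltW a0)//.
by rewrite -JE lerDl mulr_ge0 ?powR_ge0.
Qed.

Let SE N : S N = b N `^ a * f N - b 0 `^ a * f 0
  + \sum_(n < N) (b n `^ a * f n - y n).
Proof.
rewrite /S; elim: N => [|N IH]; first by rewrite !big_ord0; ring.
by rewrite !big_ord_recr/= IH; ring.
Qed.

(** Each of the two boundary terms in [SE] is at most [J N], which raises the constant [1 + a^-1] of
    [sum_u_le] to [3 + a^-1]. *)
Let S_le N : `|S N| <= (3 + a^-1) * (J N + B N).
Proof.
have H1 n : `|b n `^ a * f n| <= b n `^ a * phi n.
  by rewrite normrM ger0_norm ?powR_ge0// ler_wpM2l ?powR_ge0.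
have HN : b N `^ a * phi N <= J N.
  rewrite -JE lerDr sumr_ge0// => i _.
  by rewrite mulr_ge0// subr_ge0 bpow_le.
have H0 : b 0 `^ a * phi 0 <= J N.
  rewrite /J big_ord_recl/= lerDl sumr_ge0// => i _.
  by rewrite mulr_ge0 ?powR_ge0 ?subr_ge0.
have B0 : 0 <= B N by rewrite sumr_ge0// => i _; rewrite mulr_ge0 ?powR_ge0.
have a10 : 0 < a^-1 by rewrite invr_gt0.
rewrite SE; apply: le_trans (ler_normD _ _) _.
have := le_trans (ler_norm_sum _ _ _) (sum_u_le N).
have := ler_normB (b N `^ a * f N) (b 0 `^ a * f 0).
have := le_trans (H1 N) HN; have := le_trans (H1 0%N) H0.
have : 0 <= a^-1 * B N by rewrite mulr_ge0 ?(ltW a10).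
lra.
Qed.

(** Since [J N + B N] is at most twice the larger of the two, it suffices to apply [sum_powR_le] to
    each separately; the increments in [J N] sum to [phi N]. *)
Lemma pathwise_powR_le N :
  (forall n, \sum_(k < n) b k * increment phi k <= K) ->
  (forall n, \sum_(k < n) b k * g k <= K) ->
  `|S N| `^ p <= (2 * (3 + a^-1)) `^ p * p * K `^ (p - 1)
     * (phi N + \sum_(k < N) g k).
Proof.
move=> JK BK; have pp : 0 < p by exact: lt_trans p1.
have HJ := sum_powR_le N.+1 p1 b0 bS incr0 JK.
have HB := sum_powR_le N p1 b0 bS g0 BK.
rewrite sum_increment in HJ.
have J0 : 0 <= J N by rewrite sumr_ge0// => i _; rewrite mulr_ge0 ?powR_ge0.
have B0 : 0 <= B N by rewrite sumr_ge0// => i _; rewrite mulr_ge0 ?powR_ge0.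
have C1 : 0 <= 3 + a^-1 by rewrite addr_ge0// invr_ge0 ltW.
have C0 : 0 <= 2 * (3 + a^-1) by rewrite mulr_ge0.
have M0 : 0 <= Num.max (J N) (B N) by rewrite le_max J0.
apply: (@le_trans _ _ ((2 * (3 + a^-1) * Num.max (J N) (B N)) `^ p)).
  rewrite ge0_ler_powR ?nnegrE ?(ltW pp) ?normr_ge0 ?mulr_ge0//.
  apply: le_trans (S_le N) _.
  rewrite [leRHS]mulrAC [leRHS]mulrC ler_wpM2l// mulr_natl mulr2n.
  by rewrite lerD// le_max lexx ?orbT.
rewrite powRM// -!mulrA ler_wpM2l ?powR_ge0// mulrA mulrDr.
have [_|_] := leP (J N) (B N).
- apply: le_trans HB _; rewrite lerDr.
  by rewrite !mulr_ge0 ?powR_ge0 ?(ltW pp).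
- apply: le_trans HJ _; rewrite lerDl.
  by rewrite !mulr_ge0 ?powR_ge0 ?(ltW pp)// sumr_ge0.
Qed.

(** In [SE] the series converges absolutely by [sum_u_le]. The boundary term [b N^a f N] tends to 0
    if [b] does, as [f] is bounded; otherwise [b] has a positive limit and the convergence of
    [b n * f n] is used. *)
Lemma pathwise_cvg (Phi Gamma : R) :
  (forall n, phi n <= Phi) -> (forall n, \sum_(k < n) g k <= Gamma) ->
  cvgn (fun n => b n * f n) -> cvgn S.
Proof.
move=> phiPhi gG bfcvg.
have cS : cvgn (series (fun n => b n `^ a * f n - y n)).
  apply: normed_cvg; apply: nondecreasing_is_cvgn.
    by apply: nondecreasing_series => *; exact: normr_ge0.
  exists ((1 + a^-1) * (b 0 `^ a * Phi) + b 0 `^ a * Gamma) => _ [n _ <-].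
  rewrite /= /series/= big_mkord; apply: le_trans (sum_u_le n) _; apply: lerD.
    rewrite ler_wpM2l ?addr_ge0 ?invr_ge0 ?(ltW a0)//.
    apply: (@le_trans _ _ (b 0 `^ a * phi n)); last by rewrite ler_wpM2l ?powR_ge0.
    rewrite -(sum_increment phi) mulr_sumr ler_sum// => k _.
    by rewrite ler_wpM2r// bpow_le.
  apply: (@le_trans _ _ (b 0 `^ a * \sum_(k < n) g k)); last by rewrite ler_wpM2l ?powR_ge0.
  by rewrite mulr_sumr ler_sum// => k _; rewrite ler_wpM2r// bpow_le.
have cx : cvgn (fun n => b n `^ a * f n).
  have bcvg : cvgn b.
    apply: nonincreasing_is_cvgn; first exact/nonincreasing_seqP.
    by exists 0 => _ [n _ <-]; exact: ltW.
  have : 0 <= limn b by apply: limr_ge => //; apply: nearW => n; exact: ltW.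
  rewrite le_eqVlt => /predU1P[l0|l0].
    have bp0 : (fun n => b n `^ a * Phi) @ \oo --> 0.
      rewrite -(mul0r Phi); apply: cvgMl; apply: cvgn_powR0 => //.
        by move=> n; exact: ltW.
      by rewrite l0.
    apply/cvg_ex; exists 0; apply/cvgr0Pnorm_le => e e0.
    move/cvgr0Pnorm_le : bp0 => /(_ _ e0); apply: filterS => n; apply: le_trans.
    rewrite !normrM ler_wpM2l//; apply: le_trans (f_phi n) _.
    by apply: le_trans (phiPhi n) _; exact: ler_norm.
  rewrite (_ : (fun _ => _) = (fun n => b n `^ a * (b n)^-1 * (b n * f n))); last first.
    by apply/funext => n; rewrite -mulrA mulKf// gt_eqF.
  apply: is_cvgM => //; apply: is_cvgM.
    by apply/cvg_ex; eexists; exact: (cvgn_powR (r := a) l0 bcvg).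
  by apply: is_cvgV => //; rewrite gt_eqF.
rewrite (_ : S = (fun N => b N `^ a * f N - b 0 `^ a * f 0
   + series (fun n => b n `^ a * f n - y n) N)).
  apply: is_cvgD => //; apply: is_cvgB => //; exact: is_cvg_cst.
by apply/funext => N; rewrite SE /series/= big_mkord.
Qed.

End pathwise.

(** * Cells of the filtration and their probabilities *)

Section atoms.
Context d (T : measurableType d) (R : realType) (P : probability T R).
Variable X : atomic_filtration T.
Implicit Types (n : nat) (w v : T) (A : set T) (f : T -> R).

Definition cell n w : set T := pblock (atom_index X n) (atom X n) w.

Let cell_spec n w : atom_index X n (pblock_index (atom_index X n) (atom X n) w)
  /\ cell n w w.
Proof.
have [cov _ _] := atom_partition X n.
have [j jn jw] : cover (atom_index X n) (atom X n) w by rewrite cov.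
rewrite /cell /pblock /pblock_index.
exact: (@getPex _ [set i | atom_index X n i /\ atom X n i w] (ex_intro _ j (conj jn jw))).
Qed.

Lemma cell_mem n w : cell n w w. Proof. by have [] := cell_spec n w. Qed.

Lemma atom_cell n j w : atom_index X n j -> atom X n j w -> cell n w = atom X n j.
Proof.
move=> jn jw; have [_ tr _] := atom_partition X n.
have [in_ iw] := cell_spec n w.
by rewrite /cell /pblock; congr atom; apply: tr => //; exists w.
Qed.

Lemma cell_ex n w : exists2 j, atom_index X n j & cell n w = atom X n j.
Proof. by have [jn _] := cell_spec n w; eexists; first exact: jn. Qed.

Lemma cell_eq n w v : cell n w v -> cell n v = cell n w.
Proof. by have [j jn ->] := cell_ex n w => /(atom_cell jn). Qed.

Lemma filt_sigma_algebra n : sigma_algebra setT (X n).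
Proof. by rewrite filt_generated; exact: smallest_sigma_algebra. Qed.

Lemma filtT n : X n setT.
Proof.
have [X0 XC _] := filt_sigma_algebra n.
by rewrite -(setD0 setT); exact: XC.
Qed.

Lemma filt_atom n j : atom_index X n j -> X n (atom X n j).
Proof. by move=> jn; rewrite filt_generated; apply: sub_sigma_algebra; exists j. Qed.

Lemma filt_cell n w : X n (cell n w).
Proof. by have [j jn ->] := cell_ex n w; exact: filt_atom. Qed.

Lemma measurable_cell n w : measurable (cell n w).
Proof. exact/(filt_measurable (filt_cell n w)). Qed.

(** The sets that split no cell form a sigma-algebra containing the atoms, hence all of [X n]. *)
Lemma cell_sub n A w : X n A -> A w -> cell n w `<=` A.
Proof.
suff H : X n A -> forall u v, cell n u v -> A u <-> A v.
  by move=> XA Aw v wv; apply/(H XA _ _ wv).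
rewrite filt_generated => XA.
suff : <<s atom X n @` atom_index X n >> `<=`
    [set B | forall u v, cell n u v -> B u <-> B v] by exact.
apply: smallest_sub => [|_ [j jn <-] u v uv].
  split => [//|B HB u v uv|B HB u v uv].
    by rewrite !setTD; split=> h /(HB _ _ uv).
  by split=> -[i _ Bi]; exists i => //; apply/(HB i _ _ uv).
split=> h; first by rewrite -(atom_cell jn h).
by rewrite -(atom_cell jn h) (cell_eq uv); exact: cell_mem.
Qed.

Lemma cellS n w : cell n.+1 w `<=` cell n w.
Proof.
apply: cell_sub; last exact: cell_mem.
exact/filt_nondecreasing/filt_cell.
Qed.

(* There are only countably many cells. *)
Lemma measurable_cellwise n (g : T -> R) :
  (forall w v, cell n w v -> g v = g w) -> measurable_fun setT g.
Proof.
move=> gc _ B mB; rewrite setTI.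
have [cov _ _] := atom_partition X n.
rewrite (_ : g @^-1` B = \bigcup_(j in [set j | atom_index X n j /\
   atom X n j `<=` g @^-1` B]) atom X n j).
  by apply: bigcup_measurable => j [jn _]; exact/filt_measurable/filt_atom.
apply/seteqP; split=> [w Bw|w [j [jn sub] jw]]; last exact: sub.
have [j jn e] := cell_ex n w; exists j => /=; rewrite -e; last exact: cell_mem.
by split=> // v wv; rewrite /preimage/= (gc _ _ wv).
Qed.

(** The set is covered by the null atoms of level [n], of which there are countably many. *)
Lemma negligible_cellwise n (B : T -> Prop) :
  (forall w, B w -> P (cell n w) = 0%E) -> P.-negligible [set w | B w].
Proof.
move=> H.
apply: (@negligibleS _ _ _ P (\bigcup_j (if `[< atom_index X n j /\ P (atom X n j) = 0%E >]
   then atom X n j else set0))).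
  move=> w /H; have [j jn e] := cell_ex n w; rewrite e => P0.
  exists j => //; case: asboolP => [_|[]//].
  by rewrite -e; exact: cell_mem.
apply: negligible_bigcup => j; case: asboolP => [[jn P0]|_]; last exact: negligible_set0.
by apply/negligibleP => //; exact/filt_measurable/filt_atom.
Qed.

Lemma atom_probE n w : (atom_prob P X n w)%:E = P (cell n w).
Proof. by rewrite fineK// fin_num_measure//; exact: measurable_cell. Qed.

Lemma atom_prob_ge0 n w : 0 <= atom_prob P X n w.
Proof. by rewrite -lee_fin atom_probE. Qed.

Lemma atom_prob_le1 n w : atom_prob P X n w <= 1.
Proof. by rewrite -lee_fin atom_probE probability_le1//; exact: measurable_cell. Qed.

Lemma atom_probS n w : atom_prob P X n.+1 w <= atom_prob P X n w.
Proof.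
rewrite -lee_fin !atom_probE le_measure ?inE//; try exact: measurable_cell.
exact: cellS.
Qed.

Lemma atom_prob_cell n w v : cell n w v -> atom_prob P X n v = atom_prob P X n w.
Proof. by move=> wv; rewrite /atom_prob -/(cell n v) (cell_eq wv). Qed.

Lemma measurable_atom_prob n : measurable_fun setT (atom_prob P X n).
Proof. exact: measurable_cellwise (@atom_prob_cell n). Qed.

(** A version of a conditional expectation may take any constant value on a null atom. Identities
    that require division by the atom probability are therefore used on this set of full measure. *)
Lemma ae_atom_prob_gt0 : {ae P, forall w, forall n, 0 < atom_prob P X n w}.
Proof.
apply/ae_foralln => n; rewrite /almost_everywhere.
apply: (@negligible_cellwise n (fun w => ~ 0 < atom_prob P X n w)) => w /negP.
by rewrite -leNgt -atom_probE => h; congr EFin; apply/eqP; rewrite eq_le h atom_prob_ge0.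
Qed.

(** * Conditional expectations as averages over cells *)

Section conditional_expectation.
Variable f : T -> R.
Hypothesis intf : P.-integrable setT (EFin \o f).

Lemma E_cond_exp n : is_cond_exp P (X n) f (E_ P X n f).
Proof. exact: cond_expP (filt_sigma_algebra n) (@filt_measurable _ _ X n) intf. Qed.

(** The preimage of a single value belongs to [X n], so it contains the whole cell of each of its
    points. *)
Lemma E_cell n w v : cell n w v -> E_ P X n f v = E_ P X n f w.
Proof.
have [mE _ _] := E_cond_exp n.
have := @cell_sub n _ w (mE [set E_ P X n f w] (measurable_set1 _)) erefl v.
exact.
Qed.

Lemma measurable_E n : measurable_fun setT (E_ P X n f).
Proof. exact: measurable_cellwise (@E_cell n). Qed.

Lemma integrable_E n : P.-integrable setT (EFin \o E_ P X n f).
Proof. by have [] := E_cond_exp n. Qed.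

Lemma Rintegral_E n A : X n A ->
  \int[P]_(x in A) E_ P X n f x = \int[P]_(x in A) f x.
Proof. by have [_ _ H] := E_cond_exp n => /H; rewrite /Rintegral => ->. Qed.

(** Leaving the average undivided makes the formula valid on null atoms too. *)
Lemma atom_prob_E n w :
  atom_prob P X n w * E_ P X n f w = \int[P]_(x in cell n w) f x.
Proof.
rewrite -(Rintegral_E (filt_cell n w)) /atom_prob mulrC -/(cell n w).
rewrite -Rintegral_cst; last exact: measurable_cell.
by apply: eq_Rintegral => v; rewrite inE => /E_cell.
Qed.

End conditional_expectation.

End atoms.

(** * Domination and monotonicity of integrals *)

Lemma integrable_dominated d (T : measurableType d) (R : realType)
    (mu : {measure set T -> \bar R}) (f : T -> R) (g : T -> \bar R) :
  measurable_fun setT f -> mu.-integrable setT g ->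
  (forall x, `|f x|%:E <= g x)%E -> mu.-integrable setT (EFin \o f).
Proof.
move=> mf ig fg; apply: le_integrable ig => //; first exact/measurable_EFinP.
by move=> x _ /=; apply: le_trans (fg x) (lee_abs _).
Qed.

Lemma Rintegral_subset d (T : measurableType d) (R : realType)
    (mu : {measure set T -> \bar R}) (f : T -> R) (A B : set T) :
  measurable A -> measurable B -> A `<=` B -> (forall x, 0 <= f x) ->
  mu.-integrable setT (EFin \o f) ->
  \int[mu]_(x in A) f x <= \int[mu]_(x in B) f x.
Proof.
move=> mA mB AB f0 fi; have fiS C : measurable C -> mu.-integrable C (EFin \o f).
  by move=> mC; apply: integrableS fi.
apply: fine_le; try exact/integrable_fin_num/fiS.
apply: ge0_subset_integral => //; first exact: measurable_int (fiS _ mB).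
by move=> x _; rewrite lee_fin.
Qed.

(** * The running maximum of the martingale *)

Section maximal_function.
Context d (T : measurableType d) (R : realType) (P : probability T R).
Variables (X : atomic_filtration T) (F : T -> R).
Hypothesis H1F : H1 P X F.

Let b := atom_prob P X.
Let Fn n : T -> R := E_ P X n F.
Let Fmax := maximal_fun P X F.
Let K : R := fine (\int[P]_w Fmax w)%E.

Let intF : P.-integrable setT (EFin \o F). Proof. by case: H1F. Qed.
Let intFmax : P.-integrable setT Fmax. Proof. by case: H1F. Qed.

Fixpoint running_max n (w : T) : R :=
  if n is m.+1 then Num.max (running_max m w) `|E_ P X m.+1 F w|
  else `|E_ P X 0 F w|.
Local Notation phi := running_max.

Lemma running_maxS n w : phi n w <= phi n.+1 w.
Proof. by rewrite /= le_max lexx. Qed.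

Lemma le_running_max n w : `|E_ P X n F w| <= phi n w.
Proof. by case: n => [//|n] /=; rewrite le_max lexx orbT. Qed.

Lemma running_max_ge0 n w : 0 <= phi n w.
Proof. exact: le_trans (le_running_max n w). Qed.

Lemma running_max_le_maximal n w : ((phi n w)%:E <= maximal_fun P X F w)%E.
Proof.
have H m : (`|E_ P X m F w|%:E <= maximal_fun P X F w)%E.
  by apply: ereal_sup_ubound; exists m.
by elim: n => [|n IH] /=; rewrite ?EFin_max ?ge_max ?IH ?H.
Qed.

Lemma maximal_fun_ge0 w : (0 <= maximal_fun P X F w)%E.
Proof.
by apply: le_trans (running_max_le_maximal 0 w); rewrite lee_fin running_max_ge0.
Qed.

Lemma running_max_cell n w v : cell X n w v -> phi n v = phi n w.
Proof.
elim: n => [|n IH] wv /=; first by rewrite (E_cell intF wv).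
by rewrite (E_cell intF wv) IH//; exact: cellS wv.
Qed.

Lemma integrable_running_max n : P.-integrable setT (EFin \o phi n).
Proof.
apply: integrable_dominated intFmax _.
  exact: measurable_cellwise (@running_max_cell n).
by move=> w; rewrite ger0_norm ?running_max_ge0 ?running_max_le_maximal.
Qed.

Let incr_ge0 n w : 0 <= increment (phi^~ w) n.
Proof. by case: n => [|n] /=; rewrite ?subr_ge0 ?running_maxS ?running_max_ge0. Qed.

Lemma integral_maximal_funE : (\int[P]_w maximal_fun P X F w = K%:E)%E.
Proof. by rewrite fineK//; exact: integrable_fin_num. Qed.

(** Only the levels at which [v] still shares the cell of [w] contribute. If [m] is the last of
    them, the sum telescopes to [phi m w], which equals [phi m v]. *)
Let sum_increment_indic_le n w v :
  \sum_(k < n.+1) increment (phi^~ w) k * \1_(cell X k w) v <= phi n v.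
Proof.
have [wv|wv] := pselect (cell X n w v).
  rewrite (running_max_cell wv) -(sum_increment (phi^~ w)) ler_sum// => k _.
  by rewrite ler_piMr// indicE; case: (_ \in _).
elim: n wv => [|n IH] wv.
  rewrite big_ord1 indicE memNset// mulr0; exact: running_max_ge0.
rewrite big_ord_recr/= [X in _ * X]indicE (memNset wv) mulr0 addr0.
apply: le_trans (running_maxS _ _).
have [wv'|/IH//] := pselect (cell X n w v).
rewrite (running_max_cell wv') -(sum_increment (phi^~ w)) ler_sum// => k _.
by rewrite ler_piMr// indicE; case: (_ \in _).
Qed.

(* On the cell of [v] at level [k] the maximal function is at least
   [phi k w], so the layers of height [increment (phi^~ w) k] over the nested
   cells of [w] all fit under its graph. *)
Lemma sum_atom_prob_increment_le n w :
  \sum_(k < n) b k w * increment (phi^~ w) k <= K.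
Proof.
case: n => [|n].
  rewrite big_ord0 fine_ge0// integral_ge0// => v _; exact: maximal_fun_ge0.
rewrite -lee_fin -integral_maximal_funE -sumEFin.
apply: (@le_trans _ _ (\int[P]_v
    (\sum_(k < n.+1) (increment (phi^~ w) k * \1_(cell X k w) v)%:E))%E).
  rewrite ge0_integral_sum//.
  - apply: lee_sum => k _; rewrite (integralZl_indic _ (fun=> cell X k w))//.
    + rewrite integral_indic ?setIT//; last exact: measurable_cell.
      rewrite [X in (_ <= _ * X)%E](_ : _ = (b k w)%:E); last exact/esym/atom_probE.
      by rewrite muleC.
    + by move=> /lt_geF; rewrite incr_ge0.
    + exact: measurable_cell.
  - move=> k; apply/measurable_EFinP; apply: measurable_funM => //.
    exact/measurable_indic/measurable_cell.
  - by move=> k v _; rewrite lee_fin mulr_ge0.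
apply: ge0_le_integral => //.
- by move=> v _; apply: sume_ge0 => k _; rewrite lee_fin mulr_ge0.
- apply: emeasurable_sum => k; apply/measurable_EFinP; apply: measurable_funM => //.
  exact/measurable_indic/measurable_cell.
- exact: measurable_int intFmax.
- move=> v _; rewrite sumEFin; apply: le_trans (running_max_le_maximal n v).
  by rewrite lee_fin.
Qed.

(** * Jumps of the running maximum and the integrable majorant *)

Definition max_jump n (w : T) : R := phi n.+1 w - phi n w.
Local Notation dphi := max_jump.

Lemma max_jump_ge0 n w : 0 <= dphi n w.
Proof. by rewrite subr_ge0 running_maxS. Qed.

Lemma integrable_max_jump n : P.-integrable setT (EFin \o dphi n).
Proof.
rewrite (_ : _ \o _ = (EFin \o phi n.+1) \- (EFin \o phi n))%E//.
by apply: integrableB => //; exact: integrable_running_max.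
Qed.

Definition expected_jump n : T -> R := E_ P X n (dphi n).
Local Notation G := expected_jump.

Lemma expected_jump_ge0 n w : 0 < b n w -> 0 <= G n w.
Proof.
move=> bw; rewrite -(pmulr_rge0 _ bw) atom_prob_E; last exact: integrable_max_jump.
by apply: Rintegral_ge0 => v _; exact: max_jump_ge0.
Qed.

Lemma sum_max_jump_le n w : ((\sum_(k < n) dphi k w)%:E <= maximal_fun P X F w)%E.
Proof.
apply: le_trans (running_max_le_maximal n w); rewrite lee_fin.
by rewrite -(sum_increment (phi^~ w)) big_ord_recl/= lerDr normr_ge0.
Qed.

Lemma sum_Rintegral_max_jump_le n : \sum_(k < n) \int[P]_w dphi k w <= K.
Proof.
rewrite -lee_fin -integral_maximal_funE -sumEFin.
under eq_bigr do rewrite fineK ?(integrable_fin_num _ (integrable_max_jump _))//.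
rewrite -ge0_integral_sum//; last 2 first.
  by move=> k; exact: measurable_int (integrable_max_jump k).
  by move=> k w _; rewrite lee_fin max_jump_ge0.
apply: ge0_le_integral => //.
- by move=> v _; apply: sume_ge0 => k _; rewrite lee_fin max_jump_ge0.
- by apply: emeasurable_sum => k; exact: measurable_int (integrable_max_jump k).
- exact: measurable_int intFmax.
- by move=> v _; rewrite sumEFin; exact: sum_max_jump_le.
Qed.

(** Each term is the integral of a nonnegative jump over the cell of [w]; enlarging the cell to the
    whole space leaves the integrals of the jumps, whose sum is at most [K]. *)
Lemma sum_atom_prob_expected_jump_le n w : \sum_(k < n) b k w * G k w <= K.
Proof.
apply: le_trans (sum_Rintegral_max_jump_le n); apply: ler_sum => k _.
rewrite atom_prob_E; last exact: integrable_max_jump.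
apply: Rintegral_subset => //; first exact: measurable_cell.
  exact: max_jump_ge0.
exact: integrable_max_jump.
Qed.

Lemma integral_expected_jump n :
  (\int[P]_w `|G n w|%:E = \int[P]_w (dphi n w)%:E)%E.
Proof.
have [_ _ <-//] := E_cond_exp X (integrable_max_jump n) n; last exact: filtT.
have mG : measurable_fun setT (G n) by apply: measurable_E; exact: integrable_max_jump.
apply: ae_eq_integral => //.
- by apply/measurable_EFinP; exact: measurableT_comp.
- exact/measurable_EFinP.
- apply: filterS (ae_atom_prob_gt0 P X) => w bw _.
  by rewrite ger0_norm// expected_jump_ge0.
Qed.

(** Absolute values make the series nonnegative at every point, null atoms included; by
    [integral_expected_jump] each term still integrates to the integral of the jump itself. *)
Definition jump_dominator (w : T) : \bar R :=
  (maximal_fun P X F w + \sum_(n <oo) `|expected_jump n w|%:E)%E.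

Let measurable_normG n : measurable_fun setT (fun w => `|G n w|%:E).
Proof.
apply/measurable_EFinP; apply: measurableT_comp => //.
by apply: measurable_E; exact: integrable_max_jump.
Qed.

(** One [K] comes from the maximal function, the other from the telescoping sum of its jumps. *)
Lemma integral_jump_dominator : (\int[P]_w jump_dominator w <= 2%:E * K%:E)%E.
Proof.
rewrite ge0_integralD//; last 4 first.
- by move=> w _; exact: maximal_fun_ge0.
- exact: measurable_int intFmax.
- by move=> w _; exact: nneseries_ge0.
- by apply: ge0_emeasurable_sum => // n w _ _; rewrite lee_fin.
rewrite integral_maximal_funE integral_nneseries//.
rewrite (_ : 2%:E * K%:E = K%:E + K%:E)%E; last first.
  by rewrite -EFinM -EFinD mulr_natl mulr2n.
rewrite leeD2l// (eq_eseriesr (fun n _ => integral_expected_jump n)).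
apply: lime_le.
  by apply: is_cvg_nneseries => n _ _; apply: integral_ge0 => w _; rewrite lee_fin max_jump_ge0.
apply: nearW => n; rewrite big_mkord.
apply: le_trans (_ : ((\sum_(k < n) \int[P]_w dphi k w)%:E <= _)%E); last first.
  by rewrite lee_fin sum_Rintegral_max_jump_le.
rewrite -sumEFin; apply: lee_sum => k _.
by rewrite fineK//; exact/integrable_fin_num/integrable_max_jump.
Qed.

Lemma jump_dominator_ge0 w : (0 <= jump_dominator w)%E.
Proof. by rewrite adde_ge0 ?maximal_fun_ge0// nneseries_ge0. Qed.

Lemma measurable_jump_dominator : measurable_fun setT jump_dominator.
Proof.
apply: emeasurable_funD; first exact: measurable_int intFmax.
by apply: ge0_emeasurable_sum => // n w _ _; rewrite lee_fin.
Qed.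

Lemma le_jump_dominator n w : (forall k, 0 < b k w) ->
  ((phi n w + \sum_(k < n) G k w)%:E <= jump_dominator w)%E.
Proof.
move=> bw; rewrite EFinD leeD ?running_max_le_maximal//.
apply: le_trans (nneseries_lim_ge n _) => //.
rewrite big_mkord -sumEFin; apply: lee_sum => k _.
by rewrite lee_fin ler_norm.
Qed.

(** * Increments of the conjugate Riesz potential *)

Section conjugate_increments.
Variable a : R.
Hypothesis a0 : 0 < a.

Lemma atom_prob_powR_itv n w : 0 <= b n w `^ a <= 1.
Proof.
rewrite powR_ge0/= -[leRHS](_ : 1 `^ a = 1); last by rewrite powR1.
rewrite ge0_ler_powR ?nnegrE ?(ltW a0)//.
  exact: atom_prob_ge0.
exact: atom_prob_le1.
Qed.

Let measurable_bpow n : measurable_fun setT (fun w => b n w `^ a).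
Proof. exact: (measurableT_comp (measurable_powR a) (measurable_atom_prob P X n)). Qed.

Let integrable_bpow n f : P.-integrable setT (EFin \o f) ->
  P.-integrable setT (EFin \o (fun w => b n w `^ a * f w)).
Proof.
move=> fi; have mf : measurable_fun setT f by exact/measurable_EFinP/(measurable_int P).
apply: integrable_dominated (integrable_norm fi) _.
  exact: measurable_funM.
move=> w; rewrite lee_fin normrM; have /andP[h0 h1] := atom_prob_powR_itv n w.
by rewrite ler_piMl// ger0_norm.
Qed.

Lemma integrable_M n : P.-integrable setT (EFin \o M_ P X a n F).
Proof. exact: integrable_bpow. Qed.

(** The weight in [M_] is constant on the cell and can be taken out of the integral. *)
Lemma atom_prob_E_M n w :
  b n w * E_ P X n (M_ P X a n F) w = b n w `^ a * (b n w * Fn n w).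
Proof.
rewrite !atom_prob_E//; last exact: integrable_bpow.
rewrite -RintegralZl; last 2 first.
- exact: measurable_cell.
- by apply: integrableS intF => //; exact: measurable_cell.
by apply: eq_Rintegral => v; rewrite inE /M_ => /atom_prob_cell ->.
Qed.

Lemma E_M n w : 0 < b n w -> E_ P X n (M_ P X a n F) w = b n w `^ a * Fn n w.
Proof.
by move=> bw; apply: (mulfI (lt0r_neq0 bw)); rewrite atom_prob_E_M mulrCA.
Qed.

Let Rintegral_M n A : X n A ->
  \int[P]_(w in A) M_ P X a n F w = \int[P]_(w in A) (b n w `^ a * Fn n w).
Proof.
move=> XA; rewrite -(Rintegral_E (integrable_bpow n intF) XA) /Rintegral; congr fine.
have mA := filt_measurable XA.
apply: ae_eq_integral => //.
- apply/measurable_EFinP; apply: measurable_funTS.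
  exact/measurable_E/integrable_bpow.
- apply/measurable_EFinP; apply: measurable_funTS; apply: measurable_funM => //.
  exact: measurable_E.
- apply: filterS (ae_atom_prob_gt0 P X) => w bw _.
  by congr EFin; exact: E_M.
Qed.

(* [b n w * u] is the integral of [(b n w `^ a - b n.+1 v `^ a) * F_(n+1) v]
   over the cell of [w] at level [n]. After splitting [phi n.+1] as
   [phi n + max_jump n], the first part involves the integral of
   [b n w `^ a - b n.+1 v `^ a], which is at most [b n w `^ (1 + a)] minus the
   contribution [b n.+1 w `^ (1 + a)] of the single child cell of [w]. *)
Lemma conj_increment_le n w : 0 < b n w ->
  `|b n w `^ a * Fn n w - E_ P X n (M_ P X a n.+1 F) w|
    <= (1 + a^-1) * ((b n w `^ a - b n.+1 w `^ a) * phi n w) + b n w `^ a * G n w.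
Proof.
move=> bw; rewrite -(ler_pM2l bw) -{1}(gtr0_norm bw) -normrM mulrBr mulrCA.
set c := cell X n w; have mc : measurable c by exact: measurable_cell.
have Xc : X n.+1 c by exact/filt_nondecreasing/filt_cell.
have onc f : P.-integrable setT (EFin \o f) -> P.-integrable c (EFin \o f).
  by move=> fi; exact: integrableS fi.
have intFS : P.-integrable setT (EFin \o Fn n.+1) by exact: integrable_E.
have intb : P.-integrable setT (EFin \o (fun v => b n.+1 v `^ a)).
  rewrite (_ : (fun _ => _) = (fun v => b n.+1 v `^ a * cst 1 v)).
    by apply: integrable_bpow; exact: finite_measure_integrable_cst.
  by apply/funext => v; rewrite mulr1.
have intcst r : P.-integrable setT (EFin \o (fun=> r : R)).
  exact: (finite_measure_integrable_cst P r).
rewrite !atom_prob_E//; last exact: integrable_bpow.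
rewrite Rintegral_M// -(Rintegral_E intF Xc) -RintegralZl ?onc//.
have intZF : P.-integrable setT (EFin \o (fun v => b n w `^ a * Fn n.+1 v)).
  by have := integrableZl measurableT (b n w `^ a) intFS.
rewrite -RintegralB ?onc//; last exact: integrable_bpow.
have intdiff : P.-integrable setT (EFin \o (fun v => b n w `^ a - b n.+1 v `^ a)).
  by have := integrableB measurableT (intcst (b n w `^ a)) intb.
have inth1 : P.-integrable setT (EFin \o (fun v => phi n w * (b n w `^ a - b n.+1 v `^ a))).
  by have := integrableZl measurableT (phi n w) intdiff.
have inth2 : P.-integrable setT (EFin \o (fun v => b n w `^ a * dphi n v)).
  by have := integrableZl measurableT (b n w `^ a) (integrable_max_jump n).
have bpS v : c v -> b n.+1 v `^ a <= b n w `^ a.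
  move=> wv; rewrite ge0_ler_powR ?nnegrE ?(ltW a0) ?atom_prob_ge0//.
  by rewrite -[b n w](atom_prob_cell P wv); exact: atom_probS.
have intL : P.-integrable setT
    (EFin \o (fun v => b n w `^ a * Fn n.+1 v - b n.+1 v `^ a * Fn n.+1 v)).
  by have := integrableB measurableT intZF (integrable_bpow n.+1 intFS).
apply: le_trans (le_normr_Rintegral mc (onc _ intL)) _.
apply: (@le_trans _ _ (\int[P]_(v in c)
    (phi n w * (b n w `^ a - b n.+1 v `^ a) + b n w `^ a * dphi n v))).
  apply: le_Rintegral => //.
  - exact/onc/integrable_norm.
  - by apply/onc; have := integrableD measurableT inth1 inth2.
  move=> v cv; rewrite -mulrBl normrM ger0_norm ?subr_ge0 ?bpS//.
  have -> : phi n w = phi n v by rewrite (running_max_cell cv).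
  apply: (@le_trans _ _ ((b n w `^ a - b n.+1 v `^ a) * (phi n v + dphi n v))).
    rewrite ler_wpM2l ?subr_ge0 ?bpS// /dphi addrC subrK; exact: le_running_max.
  rewrite mulrDr [X in X + _]mulrC lerD2l ler_wpM2r ?max_jump_ge0//.
  by rewrite lerBlDr lerDl powR_ge0.
rewrite RintegralD ?onc// !RintegralZl ?onc//; last exact: integrable_max_jump.
rewrite mulrDr (mulrCA (b n w) (b n w `^ a)) atom_prob_E; last exact: integrable_max_jump.
rewrite lerD2r RintegralB ?onc//.
rewrite Rintegral_cst// -/(b n w).
have HS : b n.+1 w `^ a * b n.+1 w <= \int[P]_(v in c) (b n.+1 v `^ a).
  apply: le_trans (Rintegral_subset _ _ (@cellS _ _ X n w) _ intb) => //.
  - rewrite -Rintegral_cst; last exact: measurable_cell.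
    apply: le_Rintegral; first exact: measurable_cell.
    + by apply: integrableS (intcst _) => //; exact: measurable_cell.
    + by apply: integrableS intb => //; exact: measurable_cell.
    + by move=> v wv; rewrite /b (atom_prob_cell P wv).
  - exact: measurable_cell.
  - by move=> v; exact: powR_ge0.
have powS x : 0 <= x -> x `^ (1 + a) = x `^ a * x.
  move=> x0; rewrite powRD ?powRr1 1?mulrC//.
  by rewrite gt_eqF// addr_gt0.
(* The factor [1 + a^-1] enters here; the accompanying factor [b n w] matches the one by which the
   goal was multiplied at the start. *)
have := powR1DB_le a0 (atom_prob_ge0 P X n.+1 w) (atom_prob_ge0 P X n w).
rewrite -/(b n.+1 w) -/(b n w) !powS ?atom_prob_ge0// => Hp.
rewrite (_ : b n w * _
  = phi n w * ((1 + a^-1) * b n w * (b n w `^ a - b n.+1 w `^ a))); last ring.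
rewrite ler_wpM2l ?running_max_ge0//; apply: le_trans Hp.
by rewrite -/(b n w) lerD2l lerN2.
Qed.

End conjugate_increments.

(** The product is the integral of [F] over shrinking cells. Writing [F] as [|F|] minus the
    nonnegative function [|F| - F] gives two nonincreasing sequences bounded below by 0. *)
Lemma cvg_atom_prob_E w : cvgn (fun n => b n w * Fn n w).
Proof.
have cellmono (g : T -> R) : (forall v, 0 <= g v) -> P.-integrable setT (EFin \o g) ->
    cvgn (fun n => \int[P]_(v in cell X n w) g v).
  move=> g0 gi; apply: nonincreasing_is_cvgn.
    apply/nonincreasing_seqP => n; apply: Rintegral_subset => //; try exact: measurable_cell.
    exact: cellS.
  by exists 0 => _ [n _ <-]; apply: Rintegral_ge0.
have iN := integrable_norm intF.
have iB : P.-integrable setT (EFin \o (fun v => `|F v| - F v)).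
  by have := integrableB measurableT iN intF.
rewrite (_ : (fun _ => _) = (fun n => \int[P]_(v in cell X n w) `|F v|
   - \int[P]_(v in cell X n w) (`|F v| - F v))); last first.
  apply/funext => n; rewrite atom_prob_E// -RintegralB.
  - by apply: eq_Rintegral => v _; rewrite opprB addrC subrK.
  - exact: measurable_cell.
  - by apply: integrableS iN => //; exact: measurable_cell.
  - by apply: integrableS iB => //; exact: measurable_cell.
apply: is_cvgB; apply: cellmono => // v; rewrite subr_ge0; exact: ler_norm.
Qed.

End maximal_function.

(** * Dominated convergence in the Lebesgue space of exponent [p] *)

Lemma Lp_dominated_convergence d (T : measurableType d) (R : realType)
    (P : probability T R) (p : R) (S : nat -> T -> R) (D : T -> \bar R) :
  0 < p -> (forall N, measurable_fun setT (S N)) ->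
  (forall w, 0 <= D w)%E -> P.-integrable setT D ->
  {ae P, forall w, forall N, ((`|S N w| `^ p)%:E <= D w)%E} ->
  {ae P, forall w, cvgn (S ^~ w)} ->
  exists2 G : T -> R, Lp_cvg P p S G &
    (\int[P]_w (`|G w| `^ p)%:E <= \int[P]_w D w)%E.
Proof.
move=> p0 mS D0 iD SD Scvg.
have mD : measurable_fun setT D := measurable_int P iD.
have mpow (h : T -> R) : measurable_fun setT h ->
    measurable_fun setT (fun w => (`|h w| `^ p)%:E).
  move=> mh; apply/measurable_EFinP.
  by apply: (measurableT_comp (measurable_powR p)); exact: measurableT_comp.
have Lfunlt (h : T -> R) : measurable_fun setT h ->
    (\int[P]_w (`|h w| `^ p)%:E < +oo)%E -> h \in Lfun P p%:E.
  move=> mh hoo; apply/andP; split; rewrite inE//=.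
  by rewrite /finite_norm unlock /= poweR_lty.
(* The upper limit is measurable without any convergence; it agrees with the limit almost
   everywhere, and [fine] replaces infinite values by 0. *)
pose G w := fine (limn_esup (fun N => (S N w)%:E)).
have mG : measurable_fun setT G.
  apply: measurableT_comp => //.
  by apply: measurable_fun_limn_esup => N; exact/measurable_EFinP.
have SG : {ae P, forall w, S ^~ w @ \oo --> G w}.
  apply: filterS Scvg => w cS.
  have cE : (fun N => (S N w)%:E) @ \oo --> (limn (S ^~ w))%:E.
    by apply: cvg_EFin => //; exact: nearW.
  by rewrite /G is_cvg_limn_esupE; [rewrite (cvg_lim _ cE)|apply/cvg_ex; eexists; exact: cE].
have GD : {ae P, forall w, ((`|G w| `^ p)%:E <= D w)%E}.
  apply: filterS2 SG SD => w cS.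
  move: (D0 w); case: (D w) => [r r0 Sr|_ _|]; [|by rewrite leey|by rewrite leeNy_eq].
  (* After taking [p]-th roots, the bound passes to the limit by continuity of the absolute value
     alone. *)
  have H N : `|S N w| <= r `^ p^-1.
    rewrite -(powRr1 (normr_ge0 (S N w))) -(mulfV (lt0r_neq0 p0)) powRrM.
    by rewrite ge0_ler_powR ?invr_ge0 ?(ltW p0) ?nnegrE ?powR_ge0//; exact: Sr.
  have : `|G w| <= r `^ p^-1.
    rewrite -(cvg_lim _ (cvg_norm cS))//; apply: limr_le; last exact: nearW.
    by apply/cvg_ex; eexists; exact: (cvg_norm cS).
  move=> /(ge0_ler_powR (ltW p0)) => /(_ (normr_ge0 _) (powR_ge0 _ _)).
  by rewrite -powRrM mulVf ?lt0r_neq0// powRr1.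
have intlt (h : T -> R) : measurable_fun setT h ->
    {ae P, forall w, ((`|h w| `^ p)%:E <= D w)%E} ->
    (\int[P]_w (`|h w| `^ p)%:E <= \int[P]_w D w)%E.
  move=> mh hD; apply: ae_ge0_le_integral => //.
  - exact: mpow.
  - by apply: filterS hD => w.
have Doo : (\int[P]_w D w < +oo)%E by rewrite ltey_eq integrable_fin_num.
have mSG N : measurable_fun setT (fun w => S N w - G w) by exact: measurable_funB.
exists G; last exact: intlt.
split.
- move=> N; apply: Lfunlt => //; apply: le_lt_trans Doo; apply: intlt => //.
  by apply: filterS SD => w.
- by apply: Lfunlt => //; apply: le_lt_trans Doo; apply: intlt.
pose I N := (\int[P]_w (`|S N w - G w| `^ p)%:E)%E.
(* A difference is at most twice the larger absolute value, whence the factor [2^p]. *)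
have SGD : {ae P, forall w, forall N,
    ((`|S N w - G w| `^ p)%:E <= (2 `^ p)%:E * D w)%E}.
  apply: filterS2 SD GD => w SDw GDw N.
  apply: (@le_trans _ _ ((2 * Num.max `|S N w| `|G w|) `^ p)%:E).
    rewrite lee_fin ge0_ler_powR ?nnegrE ?(ltW p0)//.
    apply: le_trans (ler_normB _ _) _; rewrite mulr_natl mulr2n.
    by rewrite lerD// le_max lexx ?orbT.
  rewrite powRM ?le_max ?normr_ge0// EFinM lee_wpmul2l ?lee_fin ?powR_ge0//.
  by have [_|_] := leP `|S N w| `|G w|.
have [_ _] : [/\ P.-integrable setT (cst 0%E : T -> \bar R),
    [sequence \int[P]_w `|(`|S N w - G w| `^ p)%:E - cst 0%E w|]_N%E @ \oo --> 0%E
    & I @ \oo --> (\int[P]_w (cst 0%E : T -> \bar R) w)%E].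
  apply: (@dominated_convergence _ _ _ P setT measurableT
      (fun N w => (`|S N w - G w| `^ p)%:E) (cst 0%E)
      (fun w => (2 `^ p)%:E * D w)%E) => //.
  - by move=> N; exact: mpow.
  - apply: filterS SG => w cS _; apply: cvg_EFin; first exact: nearW.
    apply: cvgn_powR0 => //.
    rewrite -[X in _ --> X](@normr0 _ R) -(subrr (G w)).
    by apply: cvg_norm; apply: cvgB => //; exact: cvg_cst.
  - exact: integrableZl.
  - apply: filterS SGD => w SGDw N _ /=.
    by rewrite ger0_norm ?powR_ge0.
rewrite integral0 => Icvg.
have IE N : (I N = (fine (I N))%:E)%E.
  rewrite fineK// ge0_fin_numE; last first.
    by apply: integral_ge0 => w _; rewrite lee_fin powR_ge0.
  apply: (@le_lt_trans _ _ (\int[P]_w ((2 `^ p)%:E * D w))%E); last first.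
    by rewrite ltey_eq integrable_fin_num//; exact: integrableZl.
  apply: ae_ge0_le_integral => //.
  - exact: mpow.
  - by move=> w _; rewrite mule_ge0// lee_fin powR_ge0.
  - exact: measurable_funeM.
  - by apply: filterS SGD => w.
rewrite (_ : (fun _ => _) = (fun N => (fine (I N) `^ p^-1)%:E)); last first.
  by apply/funext => N; rewrite unlock -poweR_EFin -IE.
apply: cvg_EFin; first exact: nearW.
apply: cvgn_powR0; rewrite ?invr_gt0//.
  by move=> N; rewrite fine_ge0// integral_ge0// => w _; rewrite lee_fin powR_ge0.
exact: fine_cvg Icvg.
Qed.

(** * Assembly of the pathwise and integral estimates *)

Theorem theorem3p1 (R : realType) (p p' alpha : R) (hp : 1 < p)
    (hp' : p' = p / (p - 1)) (halpha : alpha = 1 / p') :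
  exists C : R,
    forall (d : measure_display) (T : measurableType d) (P : probability T R)
      (X : atomic_filtration T) (F : T -> R),
    H1 P X F ->
    exists2 G : T -> R,
      Lp_cvg P p (riesz_conj_partial P X alpha F) G &
      ('N[P]_(p%:E) [EFin \o G] <= C%:E * H1_norm P X F)%E.
Proof.
have p0 : 0 < p by exact: lt_trans hp.
have aE : alpha = 1 - p^-1.
  by rewrite halpha hp'; field; rewrite gt_eqF// gt_eqF// subr_gt0.
have a0 : 0 < alpha by rewrite aE subr_gt0 invf_lt1.
(* This is the constant of [pathwise_powR_le]. The bound in [integral_jump_dominator] doubles it,
   and the final [p]-th root gives the witness below. *)
pose C0 := (2 * (3 + alpha^-1)) `^ p * p.
have C00 : 0 <= C0 by rewrite mulr_ge0 ?powR_ge0 ?(ltW p0).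
have C20 : 0 <= 2 * C0 by rewrite mulr_ge0.
exists ((2 * C0) `^ p^-1) => d T P X F H1F.
pose K := fine (\int[P]_w maximal_fun P X F w)%E.
have K0 : 0 <= K.
  by rewrite fine_ge0// integral_ge0// => w _; exact: maximal_fun_ge0.
have normE : H1_norm P X F = K%:E.
  rewrite /H1_norm Lnorm1 -integral_maximal_funE//.
  by apply: eq_integral => w _; rewrite gee0_abs// maximal_fun_ge0.
have [intF _] := H1F.
have partialE N w : (forall n, 0 < atom_prob P X n w) ->
    riesz_conj_partial P X alpha F N w = \sum_(n < N)
      (atom_prob P X n.+1 w `^ (1 - p^-1) * E_ P X n.+1 F w
       - E_ P X n (M_ P X alpha n.+1 F) w).
  move=> bw; rewrite /riesz_conj_partial big_add1/= big_mkord.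
  by apply: eq_bigr => n _; rewrite E_M// aE.
pose S := riesz_conj_partial P X alpha F.
pose D w := ((C0 * K `^ (p - 1))%:E * jump_dominator P X F w)%E.
have C0K : 0 <= C0 * K `^ (p - 1) by rewrite mulr_ge0 ?powR_ge0.
have pathwise w : (forall n, 0 < atom_prob P X n w) ->
    (forall N, ((`|S N w| `^ p)%:E <= D w)%E) /\
    (jump_dominator P X F w \is a fin_num -> cvgn (S ^~ w)).
  move=> bw.
  have bS n : atom_prob P X n.+1 w <= atom_prob P X n w by exact: atom_probS.
  have phiS n : running_max P X F n w <= running_max P X F n.+1 w by exact: running_maxS.
  have Fphi n : `|E_ P X n F w| <= running_max P X F n w by exact: le_running_max.
  have G0 n : 0 <= expected_jump P X F n w by exact: expected_jump_ge0.
  have u_le n := conj_increment_le H1F a0 (bw n).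
  rewrite aE in u_le.
  split=> [N|].
    have := pathwise_powR_le hp bw bS phiS Fphi G0 u_le N
      (fun n => sum_atom_prob_increment_le H1F n w)
      (fun n => sum_atom_prob_expected_jump_le H1F n w).
    rewrite -aE /S partialE// -lee_fin -aE => /le_trans; apply.
    rewrite /D EFinM lee_wpmul2l ?lee_fin//; exact: le_jump_dominator.
  move=> Dfin.
  rewrite (_ : S ^~ w = fun N => \sum_(n < N)
      (atom_prob P X n.+1 w `^ (1 - p^-1) * E_ P X n.+1 F w
       - E_ P X n (M_ P X alpha n.+1 F) w)); last first.
    by apply/funext => N; exact: partialE.
  rewrite aE.
  have sumD n : running_max P X F n w + \sum_(k < n) expected_jump P X F k w
      <= fine (jump_dominator P X F w).
    by rewrite -lee_fin fineK//; exact: le_jump_dominator.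
  apply: (@pathwise_cvg _ p (atom_prob P X ^~ w) (fun n => E_ P X n F w)
      (running_max P X F ^~ w) (expected_jump P X F ^~ w) _ hp bw bS phiS Fphi G0 u_le
      (fine (jump_dominator P X F w)) (fine (jump_dominator P X F w))).
  - by move=> n; apply: le_trans (sumD n); rewrite lerDl sumr_ge0.
  - by move=> n; apply: le_trans (sumD n); rewrite lerDr running_max_ge0.
  - exact: cvg_atom_prob_E.
have idom : P.-integrable setT (jump_dominator P X F).
  apply/integrableP; split; first exact: measurable_jump_dominator.
  under eq_integral do rewrite gee0_abs ?jump_dominator_ge0//.
  by apply: le_lt_trans (integral_jump_dominator H1F) _; rewrite -EFinM ltry.
have mS N : measurable_fun setT (S N).
  apply: measurable_sum => n; apply: measurable_funB;
    exact/measurable_E/integrable_M.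
have [G SG GD] : exists2 G : T -> R, Lp_cvg P p S G &
    (\int[P]_w (`|G w| `^ p)%:E <= \int[P]_w D w)%E.
  apply: Lp_dominated_convergence => //.
  - by move=> w; rewrite mule_ge0 ?lee_fin ?jump_dominator_ge0.
  - exact: integrableZl.
  - by apply: filterS (ae_atom_prob_gt0 P X) => w /pathwise[].
  (* Integrability makes the majorant finite almost everywhere, which is the condition for
     convergence in [pathwise]. *)
  - apply: filterS2 (ae_atom_prob_gt0 P X) (integrable_ae measurableT idom).
    by move=> w /pathwise[_ +] Dfin; apply; exact: Dfin.
exists G => //; rewrite normE.
have {}GD : (\int[P]_w (`|G w| `^ p)%:E <= (2 * C0 * K `^ p)%:E)%E.
  apply: le_trans GD _; rewrite ge0_integralZl//; last 2 first.
  - exact: measurable_jump_dominator.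
  - by move=> w _; exact: jump_dominator_ge0.
  apply: le_trans (lee_wpmul2l _ (integral_jump_dominator H1F)) _; rewrite ?lee_fin//.
  rewrite -/K.
  have -> : K `^ p = K `^ (p - 1) * K.
    have [->|Kn] := eqVneq K 0; first by rewrite powR0 ?mulr0// gt_eqF.
    by rewrite -[in X in _ * X](powRr1 K0) -powRD ?Kn ?implybT// subrK.
  by rewrite (_ : C0 * _ * _ = 2 * C0 * (K `^ (p - 1) * K))//; ring.
rewrite unlock /=.
apply: le_trans (gt0_ler_poweR _ _ _ GD) _.
- by rewrite invr_ge0 ltW.
- by rewrite in_itv/= leey andbT integral_ge0.
- by rewrite in_itv/= leey andbT lee_fin mulr_ge0// powR_ge0.
rewrite poweR_EFin -EFinM lee_fin powRM ?powR_ge0//.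
by rewrite -powRrM mulfV ?lt0r_neq0// powRr1.
Qed.
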